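(* Let $\mathcal{X}$ be an input space, let $\mathcal{Z}_k\subseteq\mathbb{R}^d$ be a feature space equipped with the Euclidean norm, and let $h_k:\mathcal{X}\to\mathcal{Z}_k$ be a measurable representation map. Let $f:\mathcal{X}\to[0,1]$ be a labeling function and let $f_k:\mathcal{Z}_k\to[0,1]$ be the induced feature-space target function $f_k(z)=\mathbb{E}[f(x)\mid h_k(x)=z]$. Let $\{\mathcal{D}_e\}_{e}$ be a family of distributions over $\mathcal{X}$ indexed by an environment variable $e$, let $\Pi_e\ge 0$ be a probability density over environments, let the target distribution be the mixture $\mathcal{T}=\int_e \Pi_e\,\mathcal{D}_e\,\mathsf{d}e$, and let the source distribution be the finite mixture $\mathcal{S}=\sum_{i=1}^{S}\Pi_i\,\mathcal{D}_{e_i}$ with $\Pi_i\ge 0$, $\sum_{i=1}^S\Pi_i=1$. Let $\mathcal{H}$ be a class of functions $\mathcal{Z}_k\to[0,1]$, each Lipschitz continuous with Lipschitz constant $L$, and suppose $f_k$ is $\lambda$-close to $\mathcal{H}$ for some $\lambda>0$, i.e. $\inf_{h\in\mathcal{H}}[\epsilon_{\mathcal{S}}(h,f_k)+\epsilon_{\mathcal{T}}(h,f_k)]\le\lambda$. Let $X=\{x_1,\dots,x_n\}$ be drawn i.i.d. from $\mathcal{S}$ and labeled according to $f$, and let $\delta\in(0,1)$. Then for any $h\in\mathcal{H}$, with probability at least $1-\delta$, $$\epsilon_{\mathcal{T}}(h)\le \hat{\epsilon}_{\mathcal{S}}(h)+2L\sum_{i=1}^{S}\Pi_i\int_e \Pi_e\,\mathcal{W}(\widetilde{\mathcal{D}}_{e_i},\widetilde{\mathcal{D}}_e)\,\mathsf{d}e+\lambda+2\hat{\mathcal{R}}_X(\mathcal{H}')+3\sqrt{\frac{\log(2/\delta)}{2n}},$$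 where $\hat{\epsilon}_{\mathcal{S}}(h)=\frac1n\sum_{i=1}^n|h(h_k(x_i))-f(x_i)|$ and $\mathcal{H}'=\{|h\circ h_k-f| : h\in\mathcal{H}\}$.
   Context: For a distribution $\mathcal{D}$ over $\mathcal{X}$, $\widetilde{\mathcal{D}}$ denotes the induced distribution over $\mathcal{Z}_k$, $\Pr_{\widetilde{\mathcal{D}}}(A)=\Pr_{\mathcal{D}}(h_k^{-1}(A))$; in particular $\widetilde{\mathcal{S}},\widetilde{\mathcal{T}}$ are the feature distributions of $\mathcal{S},\mathcal{T}$. For $g_1,g_2:\mathcal{Z}_k\to[0,1]$, $\epsilon_{\mathcal{D}}(g_1,g_2)=\mathbb{E}_{z\sim\widetilde{\mathcal{D}}}|g_1(z)-g_2(z)|$, and $\epsilon_{\mathcal{D}}(h):=\epsilon_{\mathcal{D}}(h,f_k)$. $\mathcal{W}(P_1,P_2)=\inf_{\gamma\in\Pi(P_1,P_2)}\mathbb{E}_{(x,y)\sim\gamma}\|x-y\|_2$ is the Wasserstein-1 distance, $\Pi(P_1,P_2)$ being the set of couplings. The empirical Rademacher complexity of a class $\mathcal{F}$ of real functions on $\mathcal{X}$ w.r.t. the sample $X$ is $\hat{\mathcal{R}}_X(\mathcal{F})=\mathbb{E}_{\sigma}\big[\sup_{g\in\mathcal{F}}\frac1n\sum_{i=1}^n\sigma_i g(x_i)\big]$ with $\sigma_1,\dots,\sigma_n$ independent uniform on $\{-1,1\}$. *)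

(* Defs.v *)
From HB Require Import structures.
From mathcomp Require Import all_boot all_order all_algebra.
From mathcomp Require Import all_classical all_reals all_analysis.
From mathcomp Require Import measurable_realfun.
Set Implicit Arguments.
Unset Strict Implicit.
Unset Printing Implicit Defensive.
Import Order.TTheory GRing.Theory Num.Theory.
Import numFieldNormedType.Exports.
Local Open Scope classical_set_scope.
Local Open Scope ring_scope.

(* Feature space R^m is modelled by m.-tuple R, with its product (Borel)
   sigma-algebra from the library and the Euclidean distance below. *)
Definition eucl_dist (R : realType) (m : nat) (z1 z2 : m.-tuple R) : R :=
  Num.sqrt (\sum_(i < m) (tnth z1 i - tnth z2 i) ^+ 2).

Definition coupling (R : realType) (m : nat) (P1 P2 : probability (m.-tuple R) R)
  : set (probability (m.-tuple R * m.-tuple R)%type R) :=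
  [set g | (forall A, measurable A -> g (A `*` setT) = P1 A) /\
           (forall B, measurable B -> g (setT `*` B) = P2 B)].

Definition wasserstein1 (R : realType) (m : nat) (P1 P2 : probability (m.-tuple R) R)
  : \bar R :=
  ereal_inf [set (\int[g]_p (eucl_dist p.1 p.2)%:E)%E | g in coupling P1 P2].

Definition feat_err (R : realType) (m : nat) (dX : measure_display)
  (X : measurableType dX) (D : probability X R) (hk : {mfun X >-> m.-tuple R})
  (g1 g2 : m.-tuple R -> R) : \bar R :=
  (\int[distribution D hk]_z (`|g1 z - g2 z|)%:E)%E.

Definition is_cond_exp (R : realType) (m : nat) (dX : measure_display)
  (X : measurableType dX) (D : probability X R) (hk : {mfun X >-> m.-tuple R})
  (f : X -> R) (fk : m.-tuple R -> R) : Prop :=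
  measurable_fun setT fk /\
  forall A : set (m.-tuple R), measurable A ->
    (\int[D]_(x in hk @^-1` A) (f x)%:E = \int[distribution D hk]_(z in A) (fk z)%:E)%E.

Definition iid_sample (R : realType) (dO dX : measure_display)
  (Omega : measurableType dO) (X : measurableType dX) (P : probability Omega R)
  (n : nat) (xs : 'I_n -> Omega -> X) (D : probability X R) : Prop :=
  (forall i, measurable_fun setT (xs i)) /\
  (forall i A, measurable A -> P (xs i @^-1` A) = D A) /\
  (forall (J : {set 'I_n}) (A : 'I_n -> set X), (forall i, measurable (A i)) ->
     P (\bigcap_(i in [set j | j \in J]) (xs i @^-1` A i)) =
     (\prod_(i in J) P (xs i @^-1` A i))%E).

Definition rsign (R : realType) (b : bool) : R := if b then 1 else -1.

Definition emp_rademacher (R : realType) (T : Type) (n : nat)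
  (F : set (T -> R)) (xs : 'I_n -> T) : \bar R :=
  ((2 ^- n)%:E *
   \sum_(s : {ffun 'I_n -> bool})
      ereal_sup [set (n%:R^-1 * \sum_(i < n) rsign R (s i) * g (xs i))%:E | g in F])%E.

(* Main.v *)
Require Import Defs.
From HB Require Import structures.
From mathcomp Require Import all_boot all_order all_algebra.
From mathcomp Require Import all_classical all_reals all_analysis.
From mathcomp Require Import measurable_realfun.
From mathcomp Require Import ring lra.
Import Order.TTheory GRing.Theory Num.Theory.
Import numFieldNormedType.Exports.
Local Open Scope classical_set_scope.
Local Open Scope ring_scope.

(** The hypothesis [h] is fixed before the sample is drawn, so no uniform
    convergence is involved: the Rademacher term is nonnegative and may be
    discarded, and the factor 3 leaves room for a crude one-sided Hoeffding bound
    obtained from [exp(-x) <= 1 - x + x^2].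

    For the population part, pick a near-optimal [h'] for the joint error [lambda].
    The function [|h - h'|] is [2L]-Lipschitz, so integrating it against a coupling
    bounds its mean under [D_e] by its mean under [D_(e_i)] plus [2L] times their
    Wasserstein distance; averaging over [e] and [i] passes from [S] to [T].
    Finally [f_k] is replaced by [f] on the source by conditional Jensen. *)

(** * Integration against a mixture of measures *)

Section mixture.
Local Open Scope ereal_scope.
Import HBNNSimple.

(** The hypothesis on [mu] is the case of indicators; linearity gives simple functions and monotone
    convergence the rest. It serves twice: for the target distribution as a mixture over
    environments, and for the product formula below, with Dirac masses as [K]. *)
Lemma ge0_integral_mixture (d d' : measure_display) (E : measurableType d)
    (X : measurableType d') (R : realType) (nu : {measure set E -> \bar R})
    (w : E -> R) (K : E -> {measure set X -> \bar R})
    (mu : {measure set X -> \bar R}) (psi : X -> \bar R) :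
  (forall e, 0 <= w e)%R -> measurable_fun setT w ->
  (forall A, measurable A -> measurable_fun setT (K ^~ A)) ->
  (forall A, measurable A -> mu A = \int[nu]_e ((w e)%:E * K e A)) ->
  measurable_fun setT psi -> (forall x, 0 <= psi x) ->
  \int[mu]_x psi x = \int[nu]_e ((w e)%:E * \int[K e]_x psi x).
Proof.
move=> w0 mw mK muE mpsi psi0.
have mwE : measurable_fun setT (EFin \o w) by exact/measurable_EFinP.
have mwK (g : X -> \bar R) : measurable_fun setT g -> (forall x, 0 <= g x) ->
    measurable_fun setT (fun e => (w e)%:E * \int[K e]_x g x).
  move=> mg g0; apply: emeasurable_funM => //.
  exact: measurable_fun_integral_kernel.
have simple (g : {nnsfun X >-> R}) :
    \int[mu]_x (g x)%:E = \int[nu]_e ((w e)%:E * \int[K e]_x (g x)%:E).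
  transitivity (\int[nu]_e (\sum_(r \in range g)
      (r%:E * ((w e)%:E * K e (g @^-1` [set r]))))); last first.
    apply: eq_integral => e _; rewrite integralT_nnsfun sintegralE.
    rewrite [RHS]muleC ge0_mule_fsuml; last by move=> r; exact: nnsfun_mulemu_ge0.
    by apply: eq_fsbigr => r _; rewrite -muleA [X in _ * X]muleC.
  have gr0 r e : 0 <= r%:E * ((w e)%:E * K e (g @^-1` [set r])).
    rewrite muleCA mule_ge0 ?lee_fin// nnsfun_mulemu_ge0//.
  rewrite ge0_integral_fsum//; last first.
    move=> r; apply: measurable_funeM; apply: emeasurable_funM => //.
    exact: mK.
  rewrite integralT_nnsfun sintegralE; apply: eq_fsbigr => r /[!inE] -[x _ <-].
  rewrite muE// ge0_integralZl_EFin//.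
    by move=> e _; rewrite mule_ge0// lee_fin.
  by apply: emeasurable_funM => //; exact: mK.
(* Monotone convergence is applied at two levels along the same approximation: over [X], for [mu]
   and for each [K e], and then over [E], for the outer integral. *)
pose g := nnsfun_approx measurableT mpsi.
have cvg_int (m : {measure set X -> \bar R}) :
    \int[m]_x (g n x)%:E @[n --> \oo] --> \int[m]_x psi x.
  rewrite (_ : \int[m]_x psi x = \int[m]_x limn (fun n => (g n x)%:E)).
    apply: cvg_monotone_convergence => //.
    - by move=> n; exact/measurable_EFinP.
    - by move=> n x _; rewrite lee_fin.
    - by move=> x _ a b ab; rewrite lee_fin; exact/lefP/nd_nnsfun_approx.
  apply: eq_integral => x _; apply/esym/cvg_lim => //.
  exact: cvg_nnsfun_approx.
have nd_int (m : {measure set X -> \bar R}) :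
    nondecreasing_seq (fun n => \int[m]_x (g n x)%:E).
  move=> a b ab; apply: ge0_le_integral => //.
  - by move=> x _; rewrite lee_fin.
  - exact/measurable_EFinP.
  - exact/measurable_EFinP.
  - by move=> x _; rewrite lee_fin; exact/lefP/nd_nnsfun_approx.
rewrite -(cvg_lim _ (cvg_int mu))//; apply/cvg_lim => //.
under eq_fun do rewrite simple.
rewrite (_ : \int[nu]_e ((w e)%:E * \int[K e]_x psi x) =
    \int[nu]_e limn (fun n => (w e)%:E * \int[K e]_x (g n x)%:E)).
  apply: cvg_monotone_convergence => //.
  - move=> n; apply: (mwK (EFin \o g n)).
      exact/measurable_EFinP.
    by move=> x; rewrite lee_fin.
  - move=> n e _; rewrite mule_ge0 ?lee_fin// integral_ge0// => x _.
    by rewrite lee_fin.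
  - by move=> e _ a b ab; rewrite lee_wpmul2l ?lee_fin//; exact: nd_int.
apply: eq_integral => e _; apply/esym/cvg_lim => //.
exact: cvgeZl.
Qed.

End mixture.

(** * Expectation of a product over an i.i.d. sample *)

(** Independence is given for events only, that is, for products of indicators. The indicators are
    exchanged for [g] one index at a time, by induction. *)
Lemma iid_expectation_prod (R : realType) (dO dX : measure_display)
    (Omega : measurableType dO) (X : measurableType dX)
    (P : probability Omega R) (n : nat) (xs : 'I_n -> Omega -> X)
    (D : probability X R) (g : X -> R) :
  iid_sample P xs D -> measurable_fun setT g -> (forall x, 0 <= g x) ->
  (\int[D]_x (g x)%:E \is a fin_num)%E ->
  (\int[P]_w (\prod_(i < n) g (xs i w))%:E =
   (fine (\int[D]_x (g x)%:E) ^+ n)%:E)%E.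
Proof.
move=> [mxs [lawxs indep]] mg g0 gfin; set I := fine _.
have I0 : 0 <= I by rewrite fine_ge0// integral_ge0// => x _; rewrite lee_fin.
(* Hybrid product: [g] at the first [k] indices, the indicator of [A i] at the others; [c] collects
   the matching expectations. Keeping [A] arbitrary in the induction is what lets the set at index
   [k] vary in the induction step. *)
pose u k (A : 'I_n -> set X) (i : 'I_n) w : R :=
  if (i < k)%N then g (xs i w) else \1_(A i) (xs i w).
pose c k (A : 'I_n -> set X) (i : 'I_n) : R :=
  if (i < k)%N then I else fine (D (A i)).
have u0 k A i w : 0 <= u k A i w by rewrite /u; case: ifP.
have c0 k A i : 0 <= c k A i.
  by rewrite /c; case: ifP => // _; rewrite fine_ge0.
have mu k A i : (forall i, measurable (A i)) -> measurable_fun setT (u k A i).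
  move=> mA; rewrite /u; case: (i < k)%N.
    exact: (measurableT_comp mg (mxs i)).
  exact: (measurableT_comp (measurable_indic (mA i)) (mxs i)).
have main k : (k <= n)%N -> forall A : 'I_n -> set X,
    (forall i, measurable (A i)) ->
    (\int[P]_w (\prod_(i < n) u k A i w)%:E = (\prod_(i < n) c k A i)%:E)%E.
  elim: k => [_ A mA|k IH kn A mA].
    (* For [k = 0] all factors are indicators, and their product is the indicator of the joint
       event, to which independence over the full index set applies. *)
    transitivity (P (\bigcap_(i in [set j | j \in [set: 'I_n]%SET])
        (xs i @^-1` A i))).
      rewrite -[X in P X]setIT -integral_indic//; last first.
        apply: fin_bigcap_measurable => [|i _]; first exact: finite_finset.
        by rewrite -[X in measurable X]setTI; exact: mxs.
      apply: eq_integral => w _; congr EFin; rewrite indicE.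
      case: (boolP (w \in _)) => [/set_mem wA|/negP wA].
        rewrite big1// => i _; rewrite /u ltn0 indicE mem_set//.
        by apply: wA; rewrite /= inE.
      apply/eqP; rewrite prodf_seq_eq0; apply/hasP.
      apply: contrapT => nA; apply: wA; apply/mem_set => i _.
      apply: contrapT => nAi; apply: nA; exists i; rewrite ?mem_index_enum//=.
      by rewrite /u ltn0 indicE memNset.
    rewrite indep//.
    rewrite -prodEFin; apply: eq_big => [i|i _]; first by rewrite inE.
    by rewrite lawxs// /c ltn0 fineK// fin_num_measure.
  pose i0 := Ordinal kn.
  pose v w := \prod_(i < n | i != i0) u k A i w.
  pose e := \prod_(i < n | i != i0) c k A i.
  have e0 : 0 <= e by apply: prodr_ge0.
  have ltS (i : 'I_n) : i != i0 -> (i < k.+1)%N = (i < k)%N.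
    by move=> ii0; rewrite ltnS leq_eqVlt -[X in X || _]/(i == i0) (negbTE ii0).
  have mv : measurable_fun setT v.
    rewrite /v; under eq_fun do rewrite big_mkcond.
    by apply: measurable_prod => i _; case: (i != i0); [exact: mu|].
  have v0 w : 0 <= v w by apply: prodr_ge0.
  have uS w : \prod_(i < n) u k.+1 A i w = v w * g (xs i0 w).
    rewrite (bigD1 i0)//= mulrC {2}/u ltnSn; congr (_ * _).
    by apply: eq_bigr => i ii0; rewrite /u ltS.
  have cS : \prod_(i < n) c k.+1 A i = e * I.
    rewrite (bigD1 i0)//= mulrC {2}/c ltnSn; congr (_ * _).
    by apply: eq_bigr => i ii0; rewrite /c ltS.
  rewrite cS; under eq_integral do rewrite uS.
  have mscaleE (B : set X) : measurable B ->
      (mscale (NngNum e0) D B = \int[P]_w ((v w)%:E * \d_(xs i0 w) B))%E.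
    move=> mB; pose A' i := if i == i0 then B else A i.
    have mA' i : measurable (A' i) by rewrite /A'; case: ifP.
    have := IH (ltnW kn) A' mA'.
    rewrite (bigD1 i0)//= mulrC {2}/c ltnn /A' eqxx EFinM fineK ?fin_num_measure//.
    rewrite (eq_bigr (c k A)); last first.
      by move=> i ii0; rewrite /c (negbTE ii0).
    rewrite /mscale/= => <-; apply: eq_integral => w _.
    rewrite (bigD1 i0)//= mulrC {2}/u ltnn eqxx EFinM; congr (_%:E * _)%E.
    by apply: eq_bigr => i ii0; rewrite /u (negbTE ii0).
  have mD (B : set X) : measurable B ->
      measurable_fun setT (fun w => \d_(xs i0 w) B : \bar R).
    move=> mB; apply/measurable_EFinP.
    exact: (measurableT_comp (measurable_indic mB) (mxs i0)).
  (* The induction hypothesis, as a function of the set at index [i0], says that a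
     multiple of [D] is the [v]-weighted mixture of the Dirac masses at [xs i0 w]. *)
  have := @ge0_integral_mixture _ _ _ _ _ P v (fun w => \d_(xs i0 w))
    (mscale (NngNum e0) D) (EFin \o g) v0 mv mD mscaleE.
  have mgE : measurable_fun setT (EFin \o g) by exact/measurable_EFinP.
  have gE0 x : (0 <= (EFin \o g) x)%E by rewrite lee_fin.
  move=> /(_ mgE gE0).
  rewrite ge0_integral_mscale//=; last by move=> x _; rewrite lee_fin.
  move=> intE; rewrite EFinM fineK// intE.
  apply: eq_integral => w _; rewrite integral_dirac//.
  by rewrite diracT mul1e EFinM.
have := main n (leqnn n) (fun=> setT) (fun=> measurableT).
rewrite /c; under eq_bigr do rewrite ltn_ord.
rewrite prodr_const card_ord => <-.
apply: eq_integral => w _; congr EFin; apply: eq_bigr => i _.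
by rewrite /u ltn_ord.
Qed.

(** * An exponential inequality and the sign of the Rademacher complexity *)

(** Since [expR x >= 1 + x], the left side is at most [(1 + x)^-1], and [(1 + x) * (1 - x + x ^+ 2)
    = 1 + x ^+ 3 >= 1]. *)
Lemma expRN_le (R : realType) (x : R) : 0 <= x -> expR (- x) <= 1 - x + x ^+ 2.
Proof.
move=> x0; rewrite expRN; have x1 : 0 < 1 + x by lra.
apply: (@le_trans _ _ (1 + x)^-1).
  by rewrite lef_pV2 ?posrE ?expR_gt0// expR_ge1Dx.
rewrite -(ler_pM2l x1) divff ?gt_eqF//.
have : 0 <= x ^+ 3 by exact: exprn_ge0.
nra.
Qed.

(** Each supremum dominates the value at one fixed [g], and for fixed [g] the values cancel over all
    sign vectors, because flipping every sign is a bijection that negates them. *)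
Lemma emp_rademacher_ge0 (R : realType) (T : Type) (n : nat)
    (F : set (T -> R)) (xs : 'I_n -> T) :
  F !=set0 -> (0 <= emp_rademacher F xs)%E.
Proof.
move=> [g Fg]; rewrite /emp_rademacher mule_ge0//.
pose a (s : {ffun 'I_n -> bool}) :=
  n%:R^-1 * \sum_(i < n) rsign R (s i) * g (xs i).
apply: (@le_trans _ _ (\sum_s (a s)%:E)%E); last first.
  by apply: lee_sum => s _; apply: ereal_sup_ubound; exists g.
pose neg (s : {ffun 'I_n -> bool}) := [ffun i => ~~ s i].
have negK : involutive neg by move=> s; apply/ffunP => i; rewrite !ffunE negbK.
have aN s : a (neg s) = - a s.
  rewrite /a -mulrN -sumrN; congr (_ * _); apply: eq_bigr => i _.
  by rewrite ffunE -mulNr /rsign; case: (s i); rewrite ?opprK.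
rewrite sumEFin lee_fin.
have : \sum_s a s = - \sum_s a s.
  rewrite [LHS](reindex_inj (inv_inj negK)) -sumrN.
  by apply: eq_bigr => s _; rewrite aN.
lra.
Qed.

(** * Errors in feature space and conditional Jensen *)

Section feature_error.
Local Open Scope ereal_scope.

Lemma feat_errE (R : realType) (m : nat) (dX : measure_display)
    (X : measurableType dX) (D : probability X R) (hk : {mfun X >-> m.-tuple R})
    (g1 g2 : m.-tuple R -> R) :
  measurable_fun setT g1 -> measurable_fun setT g2 ->
  feat_err D hk g1 g2 = \int[D]_x (`|g1 (hk x) - g2 (hk x)|)%:E.
Proof.
move=> mg1 mg2; rewrite /feat_err ge0_integral_distribution//.
by apply/measurable_EFinP/measurableT_comp => //; exact: measurable_funB.
Qed.

Lemma feat_err_triangle (R : realType) (m : nat) (dX : measure_display)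
    (X : measurableType dX) (D : probability X R) (hk : {mfun X >-> m.-tuple R})
    (g1 g2 g3 : m.-tuple R -> R) :
  measurable_fun setT g1 -> measurable_fun setT g2 -> measurable_fun setT g3 ->
  feat_err D hk g1 g3 <= feat_err D hk g1 g2 + feat_err D hk g2 g3.
Proof.
move=> mg1 mg2 mg3.
have mB (f g : m.-tuple R -> R) : measurable_fun setT f -> measurable_fun setT g ->
    measurable_fun setT (fun z => (`|f z - g z|)%:E).
  move=> mf mg; apply/measurable_EFinP/measurableT_comp => //.
  exact: measurable_funB.
rewrite /feat_err -ge0_integralD//; [|exact: mB|exact: mB].
apply: ge0_le_integral => //; [exact: mB| |].
- by apply: emeasurable_funD; exact: mB.
- by move=> z _; rewrite -EFinD lee_fin ler_distD.
Qed.

Lemma feat_errC (R : realType) (m : nat) (dX : measure_display)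
    (X : measurableType dX) (D : probability X R) (hk : {mfun X >-> m.-tuple R})
    (g1 g2 : m.-tuple R -> R) :
  feat_err D hk g1 g2 = feat_err D hk g2 g1.
Proof. by rewrite /feat_err; under eq_integral do rewrite distrC. Qed.

Lemma prob_integral_le1 (R : realType) (d : measure_display)
    (X : measurableType d) (D : probability X R) (A : set X) (g : X -> R) :
  measurable A -> measurable_fun A g ->
  (forall x, A x -> 0 <= g x <= 1)%R -> \int[D]_(x in A) (g x)%:E <= 1.
Proof.
move=> mA mg g01; apply: (@le_trans _ _ (\int[D]_(x in A) (cst 1) x)).
  apply: ge0_le_integral => //.
  - by move=> x /g01/andP[]; rewrite lee_fin.
  - exact/measurable_EFinP.
  - by move=> x /g01/andP[]; rewrite lee_fin.
by rewrite integral_cst// mul1e; exact: probability_le1.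
Qed.

Lemma prob_integral_fin (R : realType) (d : measure_display)
    (X : measurableType d) (D : probability X R) (A : set X) (g : X -> R) :
  measurable A -> measurable_fun A g ->
  (forall x, A x -> 0 <= g x <= 1)%R -> \int[D]_(x in A) (g x)%:E \is a fin_num.
Proof.
move=> mA mg g01; rewrite ge0_fin_numE.
  by apply: le_lt_trans (ltry 1); exact: prob_integral_le1.
by apply: integral_ge0 => x /g01/andP[]; rewrite lee_fin.
Qed.

(* Half of conditional Jensen: where [a <= b] the absolute value drops in feature
   space. Stated for a pair [a', b'] so that it serves both signs of [h - fk]. *)
Lemma dist_le_preimage (R : realType) (d d' : measure_display)
    (X : measurableType d) (Z : measurableType d')
    (D : probability X R) (hk : {mfun X >-> Z}) (A : set Z) (a b : Z -> R)
    (a' b' : X -> R) :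
  measurable A -> measurable_fun setT a -> measurable_fun setT b ->
  measurable_fun setT a' -> measurable_fun setT b' ->
  (forall z, A z -> (0 <= a z <= 1)%R /\ (a z <= b z)%R) ->
  (forall x, 0 <= a' x)%R -> (forall x, A (hk x) -> 0 <= b' x)%R ->
  \int[distribution D hk]_(z in A) (a z)%:E =
    \int[D]_(x in hk @^-1` A) (a' x)%:E ->
  \int[distribution D hk]_(z in A) (b z)%:E =
    \int[D]_(x in hk @^-1` A) (b' x)%:E ->
  \int[distribution D hk]_(z in A) (`|a z - b z|)%:E <=
    \int[D]_(x in hk @^-1` A) (`|a' x - b' x|)%:E.
Proof.
move=> mA ma mb ma' mb' ab a'0 b'0 aE bE.
have mhA : measurable (hk @^-1` A).
  by rewrite -[X in measurable X]setTI; exact: measurable_funP.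
have mS d0 (Y : measurableType d0) (B : set Y) (f : Y -> R) :
    measurable_fun setT f -> measurable_fun B (EFin \o f).
  by move=> mf; apply/measurable_EFinP/(measurable_funS measurableT).
have afin : \int[distribution D hk]_(z in A) (a z)%:E \is a fin_num.
  apply: (@prob_integral_fin _ _ _ (distribution D hk)) => //.
    exact: measurable_funS ma.
  by move=> z /ab[].
have mab : measurable_fun setT (fun z => `|a z - b z|)%R.
  by apply: measurableT_comp => //; exact: measurable_funB.
have mab' : measurable_fun setT (fun x => `|a' x - b' x|)%R.
  by apply: measurableT_comp => //; exact: measurable_funB.
(* Adding the finite integral of [a] to both sides avoids subtraction: the left side becomes the
   integral of [b], hence of [b'], and [b' <= |a' - b'| + a'] pointwise. *)
rewrite -(leeD2rE _ _ afin) {2}aE.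
rewrite -ge0_integralD//; [|exact: mS| |exact: mS]; last first.
  by move=> z /ab[/andP[a0 _] _]; rewrite lee_fin.
rewrite -ge0_integralD//; [|exact: mS|by move=> x _; rewrite lee_fin|exact: mS].
under eq_integral => z /set_mem/ab[_ abz].
  rewrite -EFinD ler0_norm ?subr_le0//= opprB subrK; over.
rewrite bE; apply: ge0_le_integral => //.
- exact: mS.
- by apply: emeasurable_funD; exact: mS.
- move=> x _; rewrite -EFinD lee_fin distrC.
  by rewrite -lerBlDr ler_norm.
Qed.

(** Conditional Jensen for the absolute value, without a general convexity argument: on a set of
    features where [h - fk] has constant sign the left integrand is linear in [fk], so the defining
    property of [fk] exchanges it for [f]. *)
Lemma feat_err_cond_exp (R : realType) (m : nat) (dX : measure_display)
    (X : measurableType dX) (D : probability X R) (hk : {mfun X >-> m.-tuple R})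
    (Zk : set (m.-tuple R)) (f : X -> R) (fk h : m.-tuple R -> R) :
  measurable Zk -> (forall x, Zk (hk x)) ->
  measurable_fun setT f -> (forall x, 0 <= f x)%R ->
  is_cond_exp D hk f fk -> (forall z, Zk z -> 0 <= fk z <= 1)%R ->
  measurable_fun setT h -> (forall z, Zk z -> 0 <= h z <= 1)%R ->
  feat_err D hk h fk <= \int[D]_x (`|h (hk x) - f x|)%:E.
Proof.
move=> mZ hkZ mf f0 [mfk fkE] fk01 mh h01.
(* The split is by the sign of [h - fk], within [Zk] because the bounds on [h] and [fk] hold only
   there. Both pieces are measurable sets of features, as the defining property of [fk] requires. *)
pose A := Zk `&` [set z | h z <= fk z]%R.
pose B := Zk `\` [set z | h z <= fk z]%R.
have mle : measurable [set z | h z <= fk z]%R.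
  by rewrite -[X in measurable X]setTI; exact: measurable_fun_le.
have mA : measurable A by exact: measurableI.
have mB : measurable B by exact: measurableD.
have mhf : measurable_fun setT (fun x => (`|h (hk x) - f x|)%:E).
  apply/measurable_EFinP/measurableT_comp => //; apply: measurable_funB => //.
  exact: measurableT_comp.
have mhfk : measurable_fun setT (fun z => (`|h z - fk z|)%:E).
  by apply/measurable_EFinP/measurableT_comp => //; exact: measurable_funB.
have mhk (C : set (m.-tuple R)) : measurable C -> measurable (hk @^-1` C).
  by move=> mC; rewrite -[X in measurable X]setTI; exact: measurable_funP.
have mhhk : measurable_fun setT (h \o hk) by exact: measurableT_comp.
have hE (C : set (m.-tuple R)) : measurable C -> C `<=` Zk ->
    \int[distribution D hk]_(z in C) (h z)%:E =
    \int[D]_(x in hk @^-1` C) ((h \o hk) x)%:E.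
  move=> mC CZ; rewrite /distribution ge0_integral_pushforward//.
    by apply/measurable_EFinP; exact: measurable_funS mh.
  by move=> z /set_mem/CZ/h01/andP[]; rewrite lee_fin.
have ABT : setT = hk @^-1` A `|` hk @^-1` B.
  rewrite -preimage_setU setUIDK; apply/esym/seteqP; split=> // x _.
  exact: hkZ.
have dAB : [disjoint hk @^-1` A & hk @^-1` B].
  by apply/disj_setPS => x /= [[_ xA] [_ xB]]; exact: xB.
have pull (C : set (m.-tuple R)) : measurable C ->
    \int[D]_(x in hk @^-1` C) (`|h (hk x) - fk (hk x)|)%:E =
    \int[distribution D hk]_(z in C) (`|h z - fk z|)%:E.
  move=> mC; rewrite /distribution ge0_integral_pushforward//.
  exact: measurable_funS mhfk.
have mA' := mhk _ mA; have mB' := mhk _ mB.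
rewrite feat_errE// ABT !ge0_integral_setU -?ABT//; last first.
  apply/measurable_EFinP/measurableT_comp => //.
  by apply: measurable_funB => //; exact: measurableT_comp.
have hhk0 x : (0 <= h (hk x))%R by have /h01/andP[] := hkZ x.
rewrite !pull//; apply: leeD.
- apply: (@dist_le_preimage _ _ _ _ _ D hk A h fk (h \o hk) f) => //.
  + by move=> z [/h01].
  + by apply: hE => // z [].
  + by rewrite fkE.
(* On [B] the order is reversed, so [fk] takes the role of the smaller function [a]. *)
- rewrite [leLHS](_ : _ = \int[distribution D hk]_(z in B) (`|fk z - h z|)%:E).
    rewrite [leRHS](_ : _ =
        \int[D]_(x in hk @^-1` B) (`|f x - (h \o hk) x|)%:E).
      apply: (@dist_le_preimage _ _ _ _ _ D hk B fk h f (h \o hk)) => //.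
      + by move=> z [/fk01 ? /negP]; rewrite -ltNge => /ltW.
      + by move=> x _; exact: hhk0.
      + by rewrite fkE.
      + by apply: hE => // z [].
    by apply: eq_integral => x _; rewrite distrC.
  by apply: eq_integral => z _; rewrite distrC.
Qed.

End feature_error.

(** * One-sided concentration of the empirical mean *)

(** Chernoff's method: [Y ^+ 2 <= 1] bounds the mean of [expR (- (r * Y))] by [1 - r * mu + r ^+ 2],
    hence by [expR (r ^+ 2 - r * mu)]. Over [n] independent factors the total exponent is
    [n * (r ^+ 2 - r * t)]. *)
Lemma iid_lower_tail (R : realType) (dO dX : measure_display)
    (Omega : measurableType dO) (X : measurableType dX)
    (P : probability Omega R) (n : nat) (xs : 'I_n -> Omega -> X)
    (D : probability X R) (Y : X -> R) (t : R) :
  iid_sample P xs D -> measurable_fun setT Y -> (forall x, 0 <= Y x <= 1) ->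
  (0 < n)%N -> 0 < t ->
  (P [set w | (n%:R^-1 * \sum_(i < n) Y (xs i w) + t <=
      fine (\int[D]_x (Y x)%:E)%E)%R] <=
   (expR (- (n%:R * t ^+ 2 / 4)))%:E)%E.
Proof.
move=> iid mY Y01 n0 t0; set mu := fine _.
have nR0 : 0 < n%:R :> R by rewrite ltr0n.
have [mxs _] := iid.
have Yfin : (\int[D]_x (Y x)%:E)%E \is a fin_num by exact: prob_integral_fin.
(* This [r] minimises [r ^+ 2 - r * t]; the minimum is [- t ^+ 2 / 4]. *)
pose r := t / 2.
have r0 : 0 < r by rewrite divr_gt0.
pose g x := expR (- (r * Y x)).
have mg : measurable_fun setT g.
  by apply: measurableT_comp => //; apply: measurableT_comp => //; exact: measurable_funM.
have g01 x : 0 <= g x <= 1.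
  rewrite expR_ge0/= -expR0 ler_expR oppr_le0 mulr_ge0//; first exact: ltW.
  by case/andP: (Y01 x).
have gfin : (\int[D]_x (g x)%:E)%E \is a fin_num by exact: prob_integral_fin.
have gmu : fine (\int[D]_x (g x)%:E)%E <= expR (r ^+ 2 - r * mu).
  apply: (@le_trans _ _ (1 + (r ^+ 2 - r * mu))); last exact: expR_ge1Dx.
  rewrite -lee_fin fineK//.
  (* The term [r * mu] is moved to the other side, so that only nonnegative integrands are added:
     the pointwise claim is [g x + r * Y x <= 1 + r ^+ 2]. *)
  have -> : (1 + (r ^+ 2 - r * mu))%:E = ((1 + r ^+ 2)%:E - r%:E * mu%:E)%E.
    by rewrite -EFinM -EFinB addrA.
  rewrite leeBrDr// /mu fineK// -ge0_integralZl_EFin//; last 3 first.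
  - by move=> x _; rewrite lee_fin; case/andP: (Y01 x).
  - exact/measurable_EFinP.
  - exact: ltW.
  rewrite -ge0_integralD//; last 4 first.
  - by move=> x _; rewrite lee_fin; case/andP: (g01 x).
  - exact/measurable_EFinP.
  - move=> x _; rewrite -EFinM lee_fin mulr_ge0//; first exact: ltW.
    by case/andP: (Y01 x).
  - by apply/measurable_EFinP; exact: measurable_funM.
  apply: (@le_trans _ _ (\int[D]_x (cst (1 + r ^+ 2)%:E x))%E); last first.
    rewrite integral_cst// -[leRHS]mule1; apply: lee_wpmul2l.
      by rewrite lee_fin addr_ge0// sqr_ge0.
    exact: probability_le1.
  apply: ge0_le_integral => //.
  - move=> x _; rewrite -EFinM -EFinD lee_fin addr_ge0//.
      by case/andP: (g01 x).
    by rewrite mulr_ge0//; [exact: ltW|case/andP: (Y01 x)].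
  - apply/measurable_EFinP; apply: measurable_funD => //.
    exact: measurable_funM.
  - move=> x _; rewrite -EFinM -EFinD lee_fin.
    have /andP[Y0 Y1] := Y01 x.
    have rY0 : 0 <= r * Y x by rewrite mulr_ge0// ltW.
    have := @expRN_le R (r * Y x) rY0; rewrite -/(g x) exprMn => gle.
    have : Y x ^+ 2 <= 1 by rewrite expr_le1.
    have : 0 <= r ^+ 2 by rewrite sqr_ge0.
    nra.
(* [chernoff] bounds upper tails, hence the negated sum. *)
pose Z w := - \sum_(i < n) Y (xs i w).
have mZ : measurable_fun setT Z.
  apply: measurableT_comp => //; apply: measurable_sum => i.
  exact: measurableT_comp.
pose ZRV : {RV P >-> R} := mfun_Sub (mem_set mZ).
have := chernoff ZRV (n%:R * (t - mu)) r0.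
rewrite [X in (P X <= _)%E -> _](_ : _ =
    [set w | n%:R^-1 * \sum_(i < n) Y (xs i w) + t <= mu]); last first.
  apply/seteqP; suff key w : (n%:R * (t - mu) <= Z w) =
      (n%:R^-1 * \sum_(i < n) Y (xs i w) + t <= mu).
    by split=> w /=; rewrite key.
  rewrite -[RHS](ler_pM2l nR0) [in RHS]mulrDr [in RHS]mulrA divff ?gt_eqF// mul1r /Z.
  by apply/idP/idP; lra.
move=> /le_trans; apply.
have -> : (mmt_gen_fun P ZRV r = (fine (\int[D]_x (g x)%:E) ^+ n)%:E)%E.
  rewrite -(iid_expectation_prod _ _ _ _ _ _ _ _ _ _ iid mg)//; last first.
    by move=> x; case/andP: (g01 x).
  rewrite /mmt_gen_fun unlock; apply: eq_integral => w _; congr EFin.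
  rewrite /= /Z mulNr mulr_suml -sumrN expR_sum.
  by apply: eq_bigr => i _; rewrite /g [r * _]mulrC.
rewrite -EFinM lee_fin.
apply: (@le_trans _ _ (expR (r ^+ 2 - r * mu) ^+ n * expR (- (r * (n%:R * (t - mu)))))).
  rewrite ler_pM2r ?expR_gt0// lerXn2r ?nnegrE ?expR_ge0//.
  by rewrite fine_ge0// integral_ge0// => x _; rewrite lee_fin; case/andP: (g01 x).
rewrite -expRM_natl -expRD ler_expR /r.
lra.
Qed.

(** * Wasserstein distance and Lipschitz functions *)

Lemma measurable_eucl_dist (R : realType) (m : nat) :
  measurable_fun setT (fun p : m.-tuple R * m.-tuple R => eucl_dist p.1 p.2).
Proof.
apply: (measurableT_comp (continuous_measurable_fun (@sqrt_continuous R))).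
apply: measurable_sum => i; apply: measurable_funX; apply: measurable_funB.
  exact: (measurableT_comp (measurable_tnth i) measurable_fst).
exact: (measurableT_comp (measurable_tnth i) measurable_snd).
Qed.

Lemma wasserstein1_ge0 (R : realType) (m : nat) (P1 P2 : probability (m.-tuple R) R) :
  (0 <= wasserstein1 P1 P2)%E.
Proof.
apply/ereal_infP => _ [g _ <-]; apply: integral_ge0 => p _.
by rewrite lee_fin sqrtr_ge0.
Qed.


Section wasserstein.
Local Open Scope ereal_scope.
Variables (R : realType) (m : nat) (P1 P2 : probability (m.-tuple R) R).

(** Shows that couplings exist, which settles the case of Lipschitz constant zero below. *)
Lemma coupling_prod : coupling P1 P2 (P1 \x P2).
Proof.
have one (P : probability (m.-tuple R) R) : P setT = 1 by exact: probability_setT.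
split=> A mA.
  transitivity (P1 A * P2 setT); first exact: product_measure1E.
  by rewrite one mule1.
transitivity (P1 setT * P2 A); first exact: product_measure1E.
by rewrite one mul1e.
Qed.

Lemma coupling_integral_fst (g : probability (m.-tuple R * m.-tuple R)%type R)
    (phi : m.-tuple R -> \bar R) :
  coupling P1 P2 g -> measurable_fun setT phi -> (forall z, 0 <= phi z) ->
  \int[P1]_z phi z = \int[g]_p phi p.1.
Proof.
move=> [g1 _] mphi phi0.
rewrite (eq_measure_integral (pushforward g fst)); last first.
  move=> A mA _; transitivity (g (A `*` setT)); first exact/esym/g1.
  rewrite /= /pushforward; congr (g _).
  by apply/seteqP; split=> [[x y] []|[x y]].
by rewrite ge0_integral_pushforward.
Qed.

Lemma coupling_integral_snd (g : probability (m.-tuple R * m.-tuple R)%type R)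
    (phi : m.-tuple R -> \bar R) :
  coupling P1 P2 g -> measurable_fun setT phi -> (forall z, 0 <= phi z) ->
  \int[P2]_z phi z = \int[g]_p phi p.2.
Proof.
move=> [_ g2] mphi phi0.
rewrite (eq_measure_integral (pushforward g snd)); last first.
  move=> A mA _; transitivity (g (setT `*` A)); first exact/esym/g2.
  rewrite /= /pushforward; congr (g _).
  by apply/seteqP; split=> [[x y] []|[x y]].
by rewrite ge0_integral_pushforward.
Qed.

(** The easy half of Kantorovich-Rubinstein duality: integrate the Lipschitz inequality against a
    coupling, then take the infimum over couplings. The inequality is assumed on [Z] only, so it
    holds almost everywhere for each coupling. *)
Lemma wasserstein1_lipschitz (Z : set (m.-tuple R))
    (phi : m.-tuple R -> R) (C : R) :
  measurable Z -> P1 (~` Z) = 0 -> P2 (~` Z) = 0 ->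
  measurable_fun setT phi -> (forall z, 0 <= phi z)%R -> (0 <= C)%R ->
  (forall z1 z2, Z z1 -> Z z2 -> phi z2 <= phi z1 + C * eucl_dist z1 z2)%R ->
  \int[P1]_z (phi z)%:E \is a fin_num ->
  \int[P2]_z (phi z)%:E <= \int[P1]_z (phi z)%:E + C%:E * wasserstein1 P1 P2.
Proof.
move=> mZ PZ1 PZ2 mphi phi0 C0 lip fin1.
have mphiE : measurable_fun setT (EFin \o phi) by exact/measurable_EFinP.
have phiE0 z : 0 <= (EFin \o phi) z by rewrite lee_fin.
have mZC : measurable (~` Z) by exact: measurableC.
have mdist : measurable_fun setT
    (fun p : m.-tuple R * m.-tuple R => (eucl_dist p.1 p.2)%:E).
  by apply/measurable_EFinP; exact: measurable_eucl_dist.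
have dist0 (p : m.-tuple R * m.-tuple R) : 0 <= (eucl_dist p.1 p.2)%:E.
  by rewrite lee_fin sqrtr_ge0.
have mphi1 : measurable_fun setT
    (fun p : m.-tuple R * m.-tuple R => (phi p.1)%:E).
  exact: (measurableT_comp mphiE measurable_fst).
have mphi2 : measurable_fun setT
    (fun p : m.-tuple R * m.-tuple R => (phi p.2)%:E).
  exact: (measurableT_comp mphiE measurable_snd).
have le_coupling g : coupling P1 P2 g -> \int[P2]_z (phi z)%:E <=
    \int[P1]_z (phi z)%:E + C%:E * \int[g]_p (eucl_dist p.1 p.2)%:E.
  move=> cg; rewrite (coupling_integral_fst _ _ cg mphiE phiE0).
  rewrite (coupling_integral_snd _ _ cg mphiE phiE0)/=.
  have [g1 g2] := cg.
  rewrite -ge0_integralZl_EFin// -ge0_integralD//; last 3 first.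
  - by move=> p _; rewrite lee_fin.
  - by move=> p _; rewrite mule_ge0.
  - exact: measurable_funeM.
  apply: ae_ge0_le_integral => //.
  - by move=> p _; rewrite lee_fin.
  - by move=> p _; rewrite adde_ge0 ?mule_ge0// lee_fin.
  - by apply: emeasurable_funD => //; exact: measurable_funeM.
  (* The exceptional set is where one coordinate leaves [Z]; each of the two strips is null by the
     corresponding marginal. *)
  exists ((~` Z) `*` setT `|` setT `*` (~` Z)); split.
  - by apply: measurableU; apply: measurableX.
  - apply/eqP; rewrite eq_le measure_ge0 andbT.
    apply: (@le_trans _ _ (g (~` Z `*` setT) + g (setT `*` ~` Z))).
      by apply: measureU2; exact: measurableX.
    by rewrite g1// g2// PZ1 PZ2 adde0.
  - move=> [x y]/= nle; apply: contrapT => /not_orP[nx ny]; apply: nle => _.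
    rewrite -EFinM -EFinD lee_fin; apply: lip.
      by apply: contrapT => Zx; apply: nx.
    by apply: contrapT => Zy; apply: ny.
(* Passing to the infimum divides by [C], so [C = 0] is treated apart, with the product coupling. *)
move: C0; rewrite le_eqVlt => /predU1P[C0|C0].
  have := le_coupling _ coupling_prod.
  by rewrite -C0 !mul0e.
rewrite addeC -leeBlDr// -lee_pdivrMl//.
apply/ereal_infP => _ [g cg <-].
by rewrite lee_pdivrMl// leeBlDr// addeC; exact: le_coupling.
Qed.

End wasserstein.

(** * Transfer of an error from source to target *)

Section domain_shift.
Local Open Scope ereal_scope.

Lemma integral_finite_mixture (R : realType) (d : measure_display)
    (X : measurableType d) (N : nat) (p : 'I_N -> R)
    (D : 'I_N -> probability X R) (mu : {measure set X -> \bar R})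
    (psi : X -> \bar R) :
  (forall i, 0 <= p i)%R ->
  (forall A, measurable A -> mu A = \sum_(i < N) (p i)%:E * D i A) ->
  measurable_fun setT psi -> (forall x, 0 <= psi x) ->
  \int[mu]_x psi x = \sum_(i < N) (p i)%:E * \int[D i]_x psi x.
Proof.
move=> p0 muE mpsi psi0.
(* [msum] takes a sequence indexed by [nat], so the family is extended by the zero measure from
   index [N] on. *)
pose D_ k : {measure set X -> \bar R} :=
  if insub k is Some i then mscale (NngNum (p0 i)) (D i) else mzero.
have D_E (i : 'I_N) : D_ i = mscale (NngNum (p0 i)) (D i).
  by rewrite /D_ valK.
rewrite (eq_measure_integral (msum D_ N)); last first.
  move=> A mA _; rewrite [LHS]muE// /= /msum; apply: eq_bigr => i _.
  by rewrite D_E.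
rewrite ge0_integral_measure_sum//; apply: eq_bigr => i _.
by rewrite D_E ge0_integral_mscale.
Qed.

(** The Lipschitz bound compares the error under [De e] with that under [De (es i)] for each pair.
    Integrating against [PiE] and averaging with [PiS], both of total mass one, turns the two sides
    into the target and source errors. *)
Lemma feat_err_shift (R : realType)
    (dX : measure_display) (X : measurableType dX)
    (m : nat) (Zk : set (m.-tuple R)) (hk : {mfun X >-> m.-tuple R})
    (dE : measure_display) (E : measurableType dE) (nu : {measure set E -> \bar R})
    (PiE : E -> R) (De : E -> probability X R) (T : probability X R)
    (N : nat) (es : 'I_N -> E) (PiS : 'I_N -> R) (S : probability X R)
    (h1 h2 : m.-tuple R -> R) (C : R) :
  measurable Zk -> (forall x, Zk (hk x)) ->
  (forall e, 0 <= PiE e)%R -> measurable_fun setT PiE ->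
  \int[nu]_e (PiE e)%:E = 1 ->
  (forall A, measurable A -> measurable_fun setT (fun e => (De e A : \bar R))) ->
  (forall A, measurable A -> T A = \int[nu]_e ((PiE e)%:E * De e A)) ->
  (forall i, 0 <= PiS i)%R -> (\sum_(i < N) PiS i = 1)%R ->
  (forall A, measurable A -> S A = \sum_(i < N) (PiS i)%:E * De (es i) A) ->
  (forall i, measurable_fun setT
     (fun e => wasserstein1 (distribution (De (es i)) hk) (distribution (De e) hk))) ->
  measurable_fun setT h1 -> measurable_fun setT h2 ->
  (forall z, Zk z -> `|h1 z - h2 z| <= 1)%R -> (0 <= C)%R ->
  (forall z1 z2, Zk z1 -> Zk z2 ->
     `|h1 z2 - h2 z2| <= `|h1 z1 - h2 z1| + C * eucl_dist z1 z2)%R ->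
  feat_err T hk h1 h2 <= feat_err S hk h1 h2 +
    C%:E * \sum_(i < N) (PiS i)%:E * \int[nu]_e ((PiE e)%:E *
      wasserstein1 (distribution (De (es i)) hk) (distribution (De e) hk)).
Proof.
move=> mZ hkZ PiE0 mPiE PiE1 mDe TE PiS0 PiS1 SE mW mh1 mh2 h12 C0 lip.
pose phi z : R := `|h1 z - h2 z|%R.
have mphi : measurable_fun setT phi.
  by apply: measurableT_comp => //; exact: measurable_funB.
have mpsi : measurable_fun setT (fun x => (phi (hk x))%:E).
  by apply/measurable_EFinP; exact: measurableT_comp.
have psi0 x : 0 <= (phi (hk x))%:E by rewrite lee_fin normr_ge0.
pose a e := feat_err (De e) hk h1 h2.
pose W i e := wasserstein1 (distribution (De (es i)) hk) (distribution (De e) hk).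
have W0 i e : 0 <= W i e by exact: wasserstein1_ge0.
have a0 e : 0 <= a e by apply: integral_ge0 => z _; rewrite lee_fin.
have afin e : a e \is a fin_num.
  rewrite /a feat_errE//; apply: prob_integral_fin => //.
    by apply/measurable_EFinP.
  by move=> x _; rewrite normr_ge0 h12.
have SaE : feat_err S hk h1 h2 = \sum_(i < N) (PiS i)%:E * a (es i).
  rewrite feat_errE// (@integral_finite_mixture _ _ _ N PiS (De \o es))//.
  by apply: eq_bigr => i _; rewrite /a feat_errE.
have TaE : feat_err T hk h1 h2 = \int[nu]_e ((PiE e)%:E * a e).
  rewrite feat_errE// (@ge0_integral_mixture _ _ _ _ _ nu PiE De)//.
  by apply: eq_integral => e _; rewrite /a feat_errE.
have ma : measurable_fun setT a.
  rewrite (_ : a = fun e => \int[De e]_x (phi (hk x))%:E).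
    exact: measurable_fun_integral_kernel.
  by apply/funext => e; rewrite /a feat_errE.
have mPE : measurable_fun setT (EFin \o PiE) by exact/measurable_EFinP.
have PW0 i e : 0 <= (PiE e)%:E * W i e by rewrite mule_ge0// lee_fin.
have mPW i : measurable_fun setT (fun e => (PiE e)%:E * W i e).
  by apply: emeasurable_funM => //; exact: mW.
have aW i e : a e <= a (es i) + C%:E * W i e.
  (* [hk] maps into [Zk], so feature distributions are carried by [Zk], where the Lipschitz
     inequality is available. *)
  have dZ D : distribution D hk (~` Zk) = 0 :> \bar R.
    rewrite /distribution /pushforward (_ : _ @^-1` _ = set0) ?measure0//.
    by apply/seteqP; split=> // x; apply; exact: hkZ.
  apply: (@wasserstein1_lipschitz _ _ (distribution (De (es i)) hk)
    (distribution (De e) hk) Zk phi C) => //.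
  - exact: dZ.
  - exact: dZ.
  - by move=> z; rewrite /phi.
  - exact: afin.
have step i : \int[nu]_e ((PiE e)%:E * a e) <=
    a (es i) + C%:E * \int[nu]_e ((PiE e)%:E * W i e).
  apply: (@le_trans _ _ (\int[nu]_e
      (a (es i) * (PiE e)%:E + C%:E * ((PiE e)%:E * W i e)))).
    apply: ge0_le_integral => //.
    - by move=> e _; rewrite mule_ge0// lee_fin.
    - exact: emeasurable_funM.
    - by apply: emeasurable_funD; exact: measurable_funeM.
    - move=> e _; rewrite muleC (muleCA C%:E) (muleC (PiE e)%:E) -ge0_muleDl//.
        by rewrite lee_wpmul2r// lee_fin.
      by rewrite mule_ge0.
  rewrite ge0_integralD//; last 4 first.
  - by move=> e _; rewrite mule_ge0// lee_fin.
  - exact: measurable_funeM.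
  - by move=> e _; rewrite mule_ge0.
  - exact: measurable_funeM.
  rewrite ge0_integralZl//; last by move=> e _; rewrite lee_fin.
  rewrite PiE1 mule1 ge0_integralZl_EFin//.
rewrite SaE TaE.
(* The target error is written as a [PiS]-average of copies of itself, to be compared with the right
   side index by index. *)
apply: (@le_trans _ _ (\sum_(i < N) (PiS i)%:E * \int[nu]_e ((PiE e)%:E * a e))).
  have x0 : 0 <= \int[nu]_e ((PiE e)%:E * a e).
    by apply: integral_ge0 => e _; rewrite mule_ge0// lee_fin.
  rewrite -ge0_sume_distrl; last by move=> i _; rewrite lee_fin.
  by rewrite sumEFin PiS1 mul1e.
rewrite ge0_sume_distrr; last first.
  move=> i _; rewrite mule_ge0 ?lee_fin// integral_ge0// => e _; exact: PW0.
rewrite -big_split/=; apply: lee_sum => i _.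
rewrite muleCA -ge0_muleDr//; first by rewrite lee_wpmul2l ?lee_fin//; exact: step.
by rewrite mule_ge0// integral_ge0// => e _; exact: PW0.
Qed.

End domain_shift.

(** * Combination of concentration, domain shift and the joint error *)

Theorem theorem4p1 (R : realType)
  (dX : measure_display) (X : measurableType dX)
  (m : nat) (Zk : set (m.-tuple R)) (hk : {mfun X >-> m.-tuple R})
  (f : X -> R) (fk : m.-tuple R -> R)
  (dE : measure_display) (E : measurableType dE) (nu : {measure set E -> \bar R})
  (PiE : E -> R) (De : E -> probability X R) (T : probability X R)
  (Sn : nat) (es : 'I_Sn -> E) (PiS : 'I_Sn -> R) (S : probability X R)
  (H : set (m.-tuple R -> R)) (L lambda : R)
  (dO : measure_display) (Omega : measurableType dO) (P : probability Omega R)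
  (n : nat) (xs : 'I_n -> Omega -> X) (delta : R) :
  measurable Zk -> (forall x, Zk (hk x)) ->
  measurable_fun setT f -> (forall x, 0 <= f x <= 1) ->
  is_cond_exp S hk f fk -> (forall z, Zk z -> 0 <= fk z <= 1) ->
  (forall e, 0 <= PiE e) -> measurable_fun setT PiE ->
  (\int[nu]_e (PiE e)%:E = 1)%E ->
  (forall A, measurable A -> measurable_fun setT (fun e => (De e A : \bar R))) ->
  (forall A, measurable A -> T A = \int[nu]_e ((PiE e)%:E * De e A))%E ->
  (forall i, 0 <= PiS i) -> \sum_(i < Sn) PiS i = 1 ->
  (forall A, measurable A -> S A = \sum_(i < Sn) (PiS i)%:E * De (es i) A)%E ->
  0 <= L ->
  (forall h, H h ->
     [/\ measurable_fun setT h,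
         (forall z, Zk z -> 0 <= h z <= 1) &
         (forall z1 z2, Zk z1 -> Zk z2 -> `|h z1 - h z2| <= L * eucl_dist z1 z2)]) ->
  0 < lambda ->
  (ereal_inf [set (feat_err S hk h fk + feat_err T hk h fk)%E | h in H]
     <= lambda%:E)%E ->
  (forall i, measurable_fun setT
     (fun e => wasserstein1 (distribution (De (es i)) hk) (distribution (De e) hk))) ->
  (0 < n)%N -> iid_sample P xs S ->
  0 < delta < 1 ->
  forall h, H h ->
  exists Ev : set Omega,
    [/\ measurable Ev, ((1 - delta)%:E <= P Ev)%E &
    forall w, Ev w ->
      (feat_err T hk h fk <=
        (n%:R^-1 * \sum_(i < n) `|h (hk (xs i w)) - f (xs i w)|)%:E
        + (2 * L)%:E *
            (\sum_(i < Sn) (PiS i)%:E *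
               \int[nu]_e ((PiE e)%:E *
                 wasserstein1 (distribution (De (es i)) hk) (distribution (De e) hk)))
        + lambda%:E
        + 2%:E * emp_rademacher [set (fun x => (`|g (hk x) - f x|)%R) | g in H]
                   (fun i => xs i w)
        + (3 * Num.sqrt (ln (2 / delta) / (2 * n%:R)))%:E)%E].
Proof.
move=> mZ hkZ mf f01 ce fk01 PiE0 mPiE PiE1 mDe TE PiS0 PiS1 SE L0 HP lam0 infl
  mW n0 iid /andP[delta0 delta1] h Hh.
have [mh h01 lip] := HP _ Hh.
have mfk := ce.1.
pose Y x := `|h (hk x) - f x|.
have mY : measurable_fun setT Y.
  apply: measurableT_comp => //; apply: measurable_funB => //.
  exact: measurableT_comp.
have Y01 x : 0 <= Y x <= 1.
  rewrite normr_ge0/= ler_norml.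
  by have := h01 _ (hkZ x); have := f01 x; lra.
pose l := ln (2 / delta).
have l0 : 0 < l by rewrite ln_gt0// ltr_pdivlMr// mul1r; lra.
have nR0 : 0 < n%:R :> R by rewrite ltr0n.
set t := 3 * Num.sqrt (ln (2 / delta) / (2 * n%:R)).
have t0 : 0 < t by rewrite mulr_gt0// sqrtr_gt0 divr_gt0// mulr_gt0.
pose mu := fine (\int[S]_x (Y x)%:E)%E.
pose avg w := n%:R^-1 * \sum_(i < n) Y (xs i w).
(* The only random failure: the empirical error of the fixed [h] falls short of its mean by at least
   [t]. The event of the theorem is the complement. *)
pose bad := [set w | avg w + t <= mu].
have mavg : measurable_fun setT avg.
  apply: measurable_funM => //; apply: measurable_sum => i.
  by apply: measurableT_comp => //; exact: iid.1.
have mbad : measurable bad.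
  rewrite -[bad]setTI; apply: measurable_fun_le => //.
  exact: measurable_funD.
have Pbad : (P bad <= delta%:E)%E.
  apply: le_trans (iid_lower_tail _ _ _ _ _ _ _ _ _ _ _ iid mY Y01 n0 t0) _.
  rewrite lee_fin; apply: (@le_trans _ _ (expR (- l))).
    rewrite ler_expR lerN2 /t exprMn sqr_sqrtr; last first.
      by rewrite divr_ge0 ?ltW// mulr_gt0.
    (* The factor 3 in [t] makes the exponent [9 / 8 * l], which is at least [l]; and [expR (- l)]
       is [delta / 2]. *)
    have -> : n%:R * (3 ^+ 2 * (l / (2 * n%:R))) / 4 = 9 / 8 * l.
      by field; rewrite gt_eqF.
    lra.
  rewrite expRN lnK ?posrE ?divr_gt0// invf_div.
  by rewrite ler_pdivrMr//; lra.
exists (~` bad); split.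
- exact: measurableC.
- by rewrite probability_setC// EFinB leeB.
move=> w /negP; rewrite -ltNge => /ltW goodw.
have err_S : (feat_err S hk h fk <= (avg w + t)%:E)%E.
  apply: (@le_trans _ _ (\int[S]_x (Y x)%:E)%E).
    apply: (@feat_err_cond_exp _ _ _ _ _ _ Zk) => //.
    by move=> x; case/andP: (f01 x).
  by rewrite -[leLHS]fineK ?lee_fin//; exact: prob_integral_fin.
have rad0 : (0 <= emp_rademacher [set (fun x => (`|g (hk x) - f x|)%R) | g in H]
    (fun i => xs i w))%E.
  by apply: emp_rademacher_ge0; exists Y; exists h.
set rad := emp_rademacher _ _ in rad0 *.
set W := (\sum_(i < Sn) _)%E.
(* The infimum defining the joint error need not be attained, so [h'] is chosen within a slack
   [eta]. *)
apply/lee_addgt0Pr => eta eta0.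
have [_ [h' Hh' <-] h'lt] : exists2 y, [set (feat_err S hk h fk + feat_err T hk h fk)%E
    | h in H] y & (y < (lambda + eta)%:E)%E.
  by apply: ereal_inf_lt; apply: le_lt_trans infl _; rewrite lte_fin ltrDl.
have [mh' h'01 lip'] := HP _ Hh'.
have shift : (feat_err T hk h h' <= feat_err S hk h h' + (2 * L)%:E * W)%E.
  apply: (feat_err_shift R _ _ m Zk) => //.
  - move=> z Zz; rewrite ler_norml.
    by have := h01 _ Zz; have := h'01 _ Zz; lra.
  - by rewrite mulr_ge0.
  - move=> z1 z2 Z1 Z2.
    have := lip _ _ Z1 Z2; have := lip' _ _ Z1 Z2.
    (* The increments of [h] and [h'] each cost [L] times the distance, whence the constant
       [2 * L]. *)
    have -> : h z2 - h' z2 = (h z1 - h' z1) - (h z1 - h z2) + (h' z1 - h' z2) by ring.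
    move=> b' b; apply: le_trans (ler_normD _ _) _.
    apply: (le_trans (lerD (ler_normB _ _) (lexx _))).
    lra.
have W0 : (0 <= W)%E.
  apply: sume_ge0 => i _; rewrite mule_ge0 ?lee_fin// integral_ge0// => e _.
  by rewrite mule_ge0 ?lee_fin// wasserstein1_ge0.
(* Two triangle inequalities around the shift: on the target through [h'], on the source through
   [fk]. The two errors of [h'] against [fk] that remain sum to less than [lambda + eta]. *)
have T1 : (feat_err T hk h fk <=
    (avg w + t)%:E + (2 * L)%:E * W + (lambda + eta)%:E)%E.
  apply: le_trans (feat_err_triangle _ _ _ _ _ _ _ _ _ mh mh' mfk) _.
  apply: le_trans (leeD shift (lexx _)) _.
  have S1 := feat_err_triangle _ _ _ _ S hk _ _ _ mh mfk mh'.
  apply: le_trans (leeD (leeD (le_trans S1 (leeD err_S (lexx _))) (lexx _)) (lexx _)) _.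
  rewrite [in leLHS](feat_errC _ _ _ _ S hk fk h').
  move: h'lt; move: (feat_err S _ _ _) (feat_err T _ _ _) => A B /ltW AB.
  rewrite (addeAC (avg w + t)%:E) -!addeA.
  exact: (@leeD2l _ _ _ _ (@leeD2l _ _ _ _ AB)).
apply: (le_trans T1); rewrite !EFinD addeA.
rewrite (addeAC (avg w)%:E t%:E) (addeAC _ t%:E).
by do 2 apply: leeD2r; rewrite leeDl// mule_ge0// lee_fin.
Qed.
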